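(* Let $t$ be a positive integer and let $G$ be a graph. If there exists an oddomorphism $f$ from $G$ to $K_t$ (that is, a $t$-oddomorphism of $G$), then $\operatorname{tw}(G)\geq t-1$.
   Context: Graphs are finite, simple and undirected, with nonempty vertex set. $\operatorname{tw}(G)$ denotes the treewidth of $G$, i.e. the minimum over all tree decompositions $(T,\{\beta_x\}_{x\in V(T)})$ of $G$ of the width $\max_{x\in V(T)}|\beta_x|-1$. Let $f:V(G)\to S$ be a proper colouring of a graph $G$. A vertex $u\in V(G)$ is $f$-odd (respectively, $f$-even) if $N_G(u)$ contains an odd (respectively, even) number of vertices of each colour in $S\setminus\{f(u)\}$. A vertex may be neither $f$-odd nor $f$-even. A proper $t$-colouring $f:V(G)\to S$, $|S|=t$, is a $t$-oddomorphism, also called an oddomorphism from $G$ to $K_t$ (identifying $S$ with $V(K_t)$), if (1) every vertex of $G$ is either $f$-even or $f$-odd, and (2) for each colour in $S$, the colour class of that colour contains an odd number of $f$-odd vertices. *)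

(* Defs.v *)
From mathcomp Require Import all_boot.
From mathcomp Require Import boolp.

Set Implicit Arguments.
Unset Strict Implicit.
Unset Printing Implicit Defensive.

Record graph := Graph {
  vertex :> finType;
  adj : rel vertex;
  adj_sym : symmetric adj;
  adj_irr : irreflexive adj;
  vertex_gt0 : 0 < #|vertex| }.

Definition connected (G : graph) : Prop :=
  forall x y : G, connect (@adj G) x y.

Definition acyclic (G : graph) : Prop :=
  forall c : seq G, 2 < size c -> ~ ucycle (@adj G) c.

Definition tree (G : graph) : Prop := connected G /\ acyclic G.

Record tree_decomposition (G T : graph) (bag : T -> {set G}) : Prop := {
  td_tree : tree T;
  td_vertex : forall v : G, exists x : T, v \in bag x;
  td_edge : forall u v : G, adj u v ->
    exists x : T, (u \in bag x) && (v \in bag x);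
  (* the nodes whose bag contains v induce a connected subgraph of T *)
  td_connected : forall (v : G) (x y : T), v \in bag x -> v \in bag y ->
    connect [rel a b : T | [&& adj a b, v \in bag a & v \in bag b]] x y }.

(* Since G is nonempty, some bag of a tree decomposition is nonempty, so the
   truncated predecessor is a genuine subtraction. *)
Definition td_width (G T : graph) (bag : T -> {set G}) : nat :=
  (\max_(x : T) #|bag x|).-1.

Definition has_td_width (G : graph) (k : nat) : Prop :=
  exists (T : graph) (bag : T -> {set G}),
    tree_decomposition bag /\ td_width bag = k.

Lemma card_unit_gt0 : 0 < #|{: unit}|.
Proof. by rewrite card_unit. Qed.

Definition one_vertex_graph : graph :=
  @Graph unit (fun _ _ => false) (fun _ _ => erefl) (fun _ => erefl)
    card_unit_gt0.

Lemma has_td_width_exists (G : graph) : exists k, `[< has_td_width G k >].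
Proof.
exists (td_width (fun _ : one_vertex_graph => [set: G])); apply/asboolP.
exists one_vertex_graph, (fun=> [set: G]); split=> //; split.
- split=> [[] []|c c_gt2]; first exact: connect0.
  by case: c c_gt2 => [|[] [|[] c]] //= _ /andP[].
- by move=> v; exists tt; rewrite inE.
- by move=> u v _; exists tt; rewrite !inE.
- by move=> v [] [] _ _; exact: connect0.
Qed.

Definition treewidth (G : graph) : nat := ex_minn (has_td_width_exists G).

Definition nbr_colour (G : graph) (S : finType) (f : G -> S) (u : G) (c : S) :
  {set G} := [set w | adj u w & f w == c].

Definition odd_vertex (G : graph) (S : finType) (f : G -> S) (u : G) : bool :=
  [forall (c | c != f u), odd #|nbr_colour f u c|].

Definition even_vertex (G : graph) (S : finType) (f : G -> S) (u : G) : bool :=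
  [forall (c | c != f u), ~~ odd #|nbr_colour f u c|].

Definition proper_colouring (G : graph) (S : finType) (f : G -> S) : Prop :=
  forall u v : G, adj u v -> f u <> f v.

Record oddomorphism (t : nat) (G : graph) (S : finType) (f : G -> S) : Prop := {
  odm_card : #|S| = t;
  odm_proper : proper_colouring f;
  odm_parity : forall u : G, even_vertex f u \/ odd_vertex f u;
  odm_class : forall c : S, odd #|[set u | (f u == c) && odd_vertex f u]| }.

(* Main.v *)
Require Import Defs.
From mathcomp Require Import all_boot.
From mathcomp Require Import all_algebra zify.

(** If every bag had at most [t - 1] vertices, every node [x] of the tree would
    have a colour [r x] missing from its bag. Along a tree, choose edge sets
    [g x] of [K_t] such that [g x] and [g y] differ exactly by the edge
    [r x r y] when [x] and [y] are adjacent. The parity of the degree of [w] in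
    [g x], corrected by 1 at [w = r x], then does not depend on [x]; call it
    [D w]. By the handshake lemma the sum of all [D w] is odd. For a vertex [u],
    the edges of [g x] at the colour of [u] are the same for all bags containing
    [u], and their number is [D (f u)] mod 2. Summing [D (f u)] over the odd
    vertices gives the sum of all [D w], by the class condition; by the parity
    condition it is also a sum over the ordered pairs of adjacent vertices of a
    symmetric function, hence even: a contradiction. *)

Section Sums.
Import GRing.Theory.
Local Open Scope ring_scope.

(** The terms at [(i, j)] and [(j, i)] cancel in characteristic 2. This serves both the handshake
    lemma and the final sum over adjacent pairs. *)
Lemma alternating_sum_pchar2 {R : nzRingType} {I : finType} (F : I -> I -> R) :
  2 \in [pchar R] -> (forall i j, F i j = F j i) -> (forall i, F i i = 0) ->
  \sum_i \sum_j F i j = 0.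
Proof.
move=> char2 Fsym Fdiag.
pose lt (i j : I) := (enum_rank i < enum_rank j)%N.
have split_row i :
    \sum_j F i j = \sum_(j | lt i j) F i j + \sum_(j | lt j i) F i j.
  rewrite (bigID (lt i)) /=; congr (_ + _).
  rewrite (bigD1 i) /=; last by rewrite /lt ltnn.
  rewrite Fdiag add0r; apply: eq_bigl => j; rewrite /lt -leqNgt andbC ltn_neqAle.
  by rewrite (inj_eq val_inj) (inj_eq enum_rank_inj).
rewrite (eq_bigr _ (fun i _ => split_row i)) big_split /=.
rewrite [X in _ + X](exchange_big_dep xpredT) //=.
rewrite [X in _ + X](eq_bigr (fun i => \sum_(j | lt i j) F i j)).
  by rewrite addrr_pchar2.
by move=> i _; apply: eq_bigr => j _.
Qed.

(* By induction on the number of edges: the ends of a removed edge lie in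
   different components, so a potential can be shifted on one of them. *)
Lemma acyclic_potential {V : zmodType} {T : finType} {h : T -> T -> V}
    {e : rel T} :
  (forall x y, h x y = - h y x) ->
  symmetric e -> irreflexive e ->
  (forall c : seq T, (2 < size c)%N -> ~ ucycle e c) ->
  exists g : T -> V, forall x y, e x y -> g y - g x = h x y.
Proof.
move=> h_anti.
have [n] := ubnP #|[set p : T * T | e p.1 p.2]|.
elim: n e => // n IHn e; rewrite ltnS => e_le e_sym e_irr e_acyc.
case: (pickP (fun p : T * T => e p.1 p.2)) => [[x y] /= exy|no_edge]; last first.
  by exists (fun=> 0) => x y exy; have := no_edge (x, y); rewrite /= exy.
pose e' := [rel a b | e a b && ([set a; b] != [set x; y])].
have e'_sym : symmetric e' by move=> a b; rewrite /= e_sym setUC.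
have sub_e' : subrel e' e by move=> a b /andP[].
have e'_conn : connect_sym e' by apply: sym_connect_sym.
(* A shortened path from [x] to [y] would close up with the removed edge to a cycle of [e]; it has
   at least three vertices because [e'] lacks that edge. *)
have not_conn : ~~ connect e' x y.
  apply/negP => /connectP [p0 path_p0].
  case/shortenP: path_p0 => p path_p uniq_p _ y_last.
  apply: (e_acyc (x :: p)).
    case: p path_p uniq_p y_last => [|z [|z' p]] //=.
      by move=> _ _ yx; rewrite yx e_irr in exy.
    by rewrite andbT => /andP[_ /eqP ne] _ yz; rewrite yz in ne.
  rewrite /ucycle uniq_p andbT /= rcons_path (sub_path sub_e') //=.
  by rewrite -y_last e_sym.
have [|||g g_pot] := IHn e' _ e'_sym.
- apply: leq_trans e_le; apply: proper_card; apply/properP; split.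
    by apply/subsetP => p; rewrite !inE => /andP[].
  by exists (x, y); rewrite !inE //= eqxx andbF.
- by move=> a; rewrite /= e_irr.
- move=> c c_gt2 /andP[cyc_c uniq_c]; apply: (e_acyc c c_gt2).
  by rewrite /ucycle uniq_c andbT; apply: sub_cycle cyc_c.
(* [d] is the error of [g] on the removed edge; adding it on the whole component of [y] in [e']
   changes no difference along [e']. *)
pose d := h x y - (g y - g x).
exists (fun z => g z + (if connect e' y z then d else 0)) => a b eab.
have [eq_ab|ne_ab] := eqVneq [set a; b] [set x; y]; last first.
  have e'ab : e' a b by rewrite /= eab.
  have -> : connect e' y b = connect e' y a.
    by rewrite (same_connect_r e'_conn (@connect1 _ e' a b e'ab)).
  by rewrite opprD addrACA subrr addr0 g_pot.
have y_conn : connect e' y x = false by rewrite e'_conn (negbTE not_conn).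
have xy_eq : g y + d - g x = h x y.
  by rewrite /d addrAC addrC subrK.
have : a \in [set x; y] by rewrite -eq_ab set21.
have : b \in [set x; y] by rewrite -eq_ab set22.
have ne_ba : a != b by apply: contraTneq eab => ->; rewrite e_irr.
rewrite !inE => /orP[/eqP ?|/eqP ?] /orP[/eqP ?|/eqP ?]; subst a b;
  rewrite ?eqxx // in ne_ba *.
- by rewrite connect0 y_conn addr0 h_anti -xy_eq opprB.
- by rewrite connect0 y_conn addr0.
Qed.

End Sums.

Section SmallBags.
Import GRing.Theory.
Local Open Scope ring_scope.

Lemma no_oddomorphism_small_bags {G T : graph} {bag : T -> {set G}}
    {S : finType} (f : G -> S) :
  tree_decomposition bag -> (forall x, #|bag x| < #|S|)%N ->
  ~ oddomorphism #|S| f.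
Proof.
move=> [[T_conn T_acyc] cover cover_edge bag_conn] small.
move=> [_ f_proper f_parity f_class].
have char2 : 2%N \in [pchar 'F_2] by [].
have missing x : exists c, c \notin f @: bag x.
  have : ~~ ([set: S] \subset f @: bag x).
    apply: contraL (small x) => /subset_leq_card; rewrite cardsT -leqNgt => le.
    exact: leq_trans le (leq_imset_card _ _).
  by case/subsetPn => c _; exists c.
pose r x := xchoose (missing x).
have r_fresh x u : u \in bag x -> f u != r x.
  move=> ux; apply: contraNneq (xchooseP (missing x)) => fu.
  by rewrite -[xchoose _]fu imset_f.
(* Edge sets are ['F_2]-valued functions, so that addition is symmetric difference. If [r x = r y],
   the set is a singleton, which the sum in [D] below never meets. *)
pose h x y : {ffun {set S} -> 'F_2} :=
  [ffun E => (E == [set r x; r y])%:R].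
have h_anti x y : h x y = - h y x.
  by apply/ffunP => E; rewrite !ffunE setUC oppr_pchar2.
have [g g_pot] := acyclic_potential h_anti (@adj_sym T) (@adj_irr T) T_acyc.
have g_step x y E : adj x y -> g y E = g x E + (E == [set r x; r y])%:R.
  by move=> /g_pot/ffunP/(_ E); rewrite !ffunE => <-; rewrite addrC subrK.
pose D x w : 'F_2 := \sum_(c | c != w) g x [set w; c] + (w == r x)%:R.
have pair_eq (w c a b : S) : c != w -> ([set w; c] == [set a; b])%:R =
    (w == a)%:R * (c == b)%:R + (w == b)%:R * (c == a)%:R :> 'F_2.
  move=> cw; have -> : ([set w; c] == [set a; b]) =
     (w == a) && (c == b) || (w == b) && (c == a).
    apply/eqP/orP => [E|[]/andP[/eqP-> /eqP->]] //; last by rewrite setUC.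
    have : w \in [set a; b] by rewrite -E set21.
    have : c \in [set a; b] by rewrite -E set22.
    rewrite !inE => /orP[]/eqP ? /orP[]/eqP ?; subst c w;
      by rewrite !eqxx // in cw *; auto.
  case: (eqVneq w a) cw => [->|_] cw /=.
    by rewrite (negbTE cw) andbF orbF mulr0 addr0 mul1r.
  by rewrite mul0r add0r -natrM mulnb.
have sum_delta (w b : S) : \sum_(c | c != w) (c == b)%:R = (b != w)%:R :> 'F_2.
  have [->|bw] := eqVneq b w; first by rewrite big1 // => c /negbTE->.
  by rewrite (bigD1 b) //= eqxx big1 ?addr0 // => c /andP[_ /negbTE->].
(* Toggling an edge changes the degree parity at its two ends only; moving the correction from [r x]
   to [r y] makes up for this. *)
have D_step x y w : adj x y -> D x w = D y w.
  move=> xy; rewrite /D (eq_bigr _ (fun c _ => g_step x y [set w; c] xy)).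
  rewrite big_split /= (eq_bigr _ (fun c => @pair_eq w c (r x) (r y))).
  rewrite big_split /= -!mulr_sumr !sum_delta -!addrA; congr (_ + _).
  rewrite ![r _ == w]eq_sym.
  by case: (w == r x); case: (w == r y); apply/eqP.
have D_const x y w : D x w = D y w.
  case/connectP: (T_conn x y) => p; elim: p x => [|z p IHp] x /=.
    by move=> _ ->.
  by case/andP=> xz /IHp{}IHp /IHp <-; apply: D_step.
have [x0 _] : exists x0 : T, x0 \in predT by apply/card_gt0P/vertex_gt0.
have D_sum : \sum_w D x0 w = 1.
  rewrite big_split /= -[RHS]add0r; congr (_ + _); last first.
    by rewrite (bigD1 (r x0)) //= eqxx big1 ?addr0 // => w /negbTE->.
  rewrite (eq_bigr (fun w => \sum_c if c != w then g x0 [set w; c] else 0)).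
    apply: alternating_sum_pchar2 => // [a b|a]; last by rewrite eqxx.
    by rewrite eq_sym setUC.
  by move=> w _; rewrite -big_mkcond.
have g_bag u x y c : u \in bag x -> u \in bag y ->
    g x [set f u; c] = g y [set f u; c].
  move=> ux uy; case/connectP: (bag_conn u x y ux uy) => p.
  elim: p x ux => [|z p IHp] x ux /=; first by move=> _ ->.
  case/andP=> /and3P[xz _ uz] /(IHp z uz){}IHp /IHp <-.
  (* As [u] lies in both bags, [r x] and [r z] differ from [f u], so the toggled edge misses the
     colour [f u]. *)
  rewrite (g_step x z) //; case: eqP => [E|_]; last by rewrite addr0.
  have : f u \in [set r x; r z] by rewrite -E set21.
  by rewrite !inE (negbTE (r_fresh _ _ ux)) (negbTE (r_fresh _ _ uz)).
have home_ex u : exists x, u \in bag x by apply: cover.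
pose home u := xchoose (home_ex u).
have homeP u : u \in bag (home u) := xchooseP (home_ex u).
(* By [g_bag], any other bag containing [u] gives the same value. *)
pose X u c := g (home u) [set f u; c].
have X_sym u v : adj u v -> X u (f v) = X v (f u).
  case/cover_edge=> x /andP[ux vx].
  by rewrite /X (@g_bag u _ x) // (@g_bag v _ x) // setUC.
have X_sum u : \sum_(c | c != f u) X u c = D x0 (f u).
  rewrite (D_const x0 (home u)) /D (negbTE (r_fresh _ _ (homeP u))).
  by rewrite addr0.
have sum_D : \sum_(u | odd_vertex f u) D x0 (f u) = 1.
  rewrite -D_sum (partition_big f xpredT) //=; apply: eq_bigr => w _.
  rewrite (eq_bigr (fun=> D x0 w)); last by move=> u /andP[_ /eqP->].
  rewrite sumr_const -mulr_natl.
  have -> : #|[pred u | odd_vertex f u & f u == w]| =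
            #|[set u | (f u == w) && odd_vertex f u]|.
    by rewrite cardsE; apply: eq_card => u; rewrite !inE andbC.
  by rewrite -(GRing.natr_mod_pchar char2) modn2 f_class mul1r.
have sum_0 : \sum_(u | odd_vertex f u) D x0 (f u) = 0.
  transitivity (\sum_u \sum_v if adj u v then X u (f v) else 0); last first.
    apply: (alternating_sum_pchar2 _ char2) => [u v|u]; last by rewrite adj_irr.
    by rewrite adj_sym; case: ifP => // /X_sym.
  rewrite big_mkcond; apply: eq_bigr => u _.
  rewrite -big_mkcond /= (partition_big f (fun c => c != f u)) /=; last first.
    by move=> v /f_proper/eqP; rewrite eq_sym.
  (* Modulo 2, the number of neighbours of colour [c] is 1 if [u] is odd and 0 otherwise, by
     [f_parity]. *)
  rewrite (eq_bigr (fun c => (odd_vertex f u)%:R * X u c)) => [|c cu].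
    by rewrite -mulr_sumr X_sum; case: odd_vertex; rewrite ?mul1r ?mul0r.
  rewrite (eq_bigr (fun=> X u c)); last by move=> v /andP[_ /eqP->].
  rewrite sumr_const -[LHS]mulr_natl.
  have -> : #|[pred v | adj u v & f v == c]| = #|nbr_colour f u c|.
    by rewrite cardsE.
  rewrite -[X in X * _](GRing.natr_mod_pchar char2) modn2.
  have [odd_u|not_odd] := boolP (odd_vertex f u).
    by move/forallP/(_ c)/implyP/(_ cu): odd_u => ->.
  case: (f_parity u) => [/forallP/(_ c)/implyP/(_ cu)/negbTE -> //|].
  by rewrite (negbTE not_odd).
by move: sum_D; rewrite sum_0.
Qed.

End SmallBags.

Theorem theorem1p10 (t : nat) (G : graph) :
  0 < t ->
  (exists (S : finType) (f : G -> S), oddomorphism t f) ->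
  t - 1 <= treewidth G.
Proof.
move=> t_gt0 [S [f f_odd]]; rewrite /treewidth.
case: ex_minnP => k /boolp.asboolP[T [bag [bag_td <-]]] _.
rewrite leqNgt; apply/negP => small.
have card_S := odm_card f_odd; subst t.
apply: (no_oddomorphism_small_bags f bag_td) f_odd => x.
by have := @leq_bigmax T (fun y => #|bag y|) x; move: small; rewrite /td_width; lia.
Qed.
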